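(* Let $n$ be a positive integer, let $d(n)$ be the number of positive divisors of $n$, and let $d_{2,4}(n)$ be the number of positive divisors of $n$ congruent to $2$ modulo $4$. Then \[ d(n) - 4d_{2, 4}(n) = \sum_{\pi \in \mathcal{P}^{\ast}(n)} (-1)^{\#(\pi) - 1} \omega(\pi), \qquad\text{where}\qquad \omega(\pi) := \nu(\ell(\pi))\prod_{i=1}^{\ell(\pi) - 1} \big(2\nu(i) - 1\big). \]
   Context: $\mathcal{P}^{\ast}(n)$ is the set of partitions of $n$ whose set of distinct parts is exactly $\{1,2,\dots,\ell(\pi)\}$ (i.e. every integer from $1$ to the largest part occurs at least once). For a partition $\pi$, $\ell(\pi)$ is its largest part, $\#(\pi)$ its number of parts, and $\nu(j)$ the number of times the integer $j$ occurs as a part of $\pi$. *)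

(* Defs.v *)
From HB Require Import structures.
From mathcomp Require Import all_boot all_order all_algebra.

Set Implicit Arguments.
Unset Strict Implicit.
Unset Printing Implicit Defensive.

Import GRing.Theory.

(* Parts are listed in weakly decreasing order. *)
Definition is_partition (n : nat) (s : seq nat) : bool :=
  [&& sorted geq s, 0 \notin s & sumn s == n].

Record partition_of (n : nat) : Type := PartitionOf {
  parts :> seq nat;
  parts_partition : is_partition n parts
}.

HB.instance Definition _ (n : nat) := [isSub of partition_of n for @parts n].
HB.instance Definition _ (n : nat) := [Countable of partition_of n by <:].

(* A partition of n has at most n parts, each at most n; this bound provides
   the finite enumeration of partition_of n. *)
Section PartitionFinite.
Variable n : nat.
Implicit Type p : partition_of n.

Lemma leq_sumn_mem (s : seq nat) (x : nat) : x \in s -> x <= sumn s.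
Proof.
elim: s => //= y s IHs; rewrite inE => /orP[/eqP->|/IHs]; first exact: leq_addr.
by move/leq_trans; apply; exact: leq_addl.
Qed.

Lemma size_leq_sumn (s : seq nat) : 0 \notin s -> size s <= sumn s.
Proof.
elim: s => //= y s IHs; rewrite inE negb_or eq_sym -lt0n => /andP[y0 /IHs].
by rewrite -add1n; exact: leq_add.
Qed.

Lemma size_parts p : size (map (@inord n) p) <= n.
Proof.
by case: p => s /= /and3P[_ s0 /eqP<-]; rewrite size_map; exact: size_leq_sumn.
Qed.

Definition partition_code p : {bseq n of 'I_n.+1} := Bseq (size_parts p).

Definition partition_decode (b : {bseq n of 'I_n.+1}) : option (partition_of n) :=
  insub (map val b).

Lemma partition_codeK : pcancel partition_code partition_decode.
Proof.
move=> p; rewrite /partition_decode /= -map_comp.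
suff -> : map (val \o @inord n) p = parts p by rewrite valK.
rewrite -[RHS]map_id; apply/eq_in_map => x xp /=; rewrite inordK //.
by case: p xp => s /= /and3P[_ _ /eqP<-]; exact: leq_sumn_mem.
Qed.

HB.instance Definition _ : isFinite (partition_of n) :=
  PCanIsFinite partition_codeK.

End PartitionFinite.

Section Statistics.
Variables (n : nat) (p : partition_of n).

Definition largest_part : nat := \max_(i <- parts p) i.

Definition num_parts : nat := size (parts p).

Definition mult (j : nat) : nat := count_mem j (parts p).

(* The set of distinct parts is exactly {1, ..., largest_part}. *)
Definition gap_free : bool := perm_eq (undup (parts p)) (iota 1 largest_part).

Local Open Scope ring_scope.

Definition omega : int :=
  (mult largest_part)%:Z *
  \prod_(1 <= i < largest_part) (2 * (mult i)%:Z - 1).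

End Statistics.

Definition Pstar (n : nat) : {set partition_of n} := [set p | gap_free p].

Definition num_divisors (n : nat) : nat := size (divisors n).

Definition num_divisors_2_4 (n : nat) : nat :=
  count (fun d => d == 2 %[mod 4]) (divisors n).

(* Main.v *)
Require Import Defs.
From HB Require Import structures.
From mathcomp Require Import all_boot all_order all_algebra.
From mathcomp Require Import zify ring.

Set Implicit Arguments.
Unset Strict Implicit.
Unset Printing Implicit Defensive.

Import GRing.Theory.
Local Open Scope ring_scope.

(** Modulo [q ^ n.+1] the right-hand side is the coefficient of [q ^ n] in
      sum_{l >= 1} q^l / (1 + q^l)^2 *
        prod_{1 <= i < l} (- q^i (1 - q^i) / (1 + q^i)^2),
    since sum m x^m = x / (1 - x)^2 and sum (2 m - 1) x^m = x (1 + x) / (1 - x)^2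
    are used at x = - q^i.  A telescoping (WZ-type) argument turns this series
    into sum_{k >= 1} q^(k^2) (1 - q^k) / (1 + q^k), whose coefficient of [q ^ n]
    is sum_{d | n} (-1)^(d + n / d) = d(n) - 4 d_{2,4}(n).  Power series are
    handled in a commutative ring where q is nilpotent, eventually
    Z[X] / (X^(n+1)). *)

(** * Truncated factor series and their closed forms *)

Section Series.
Variables (R : comNzRingType) (N : nat).

Definition geom_series (x : R) : R := \sum_(j < N) (- x) ^+ j.

Definition largest_factor (x : R) : R := \sum_(1 <= m < N) (- x) ^+ m *+ m.

Definition inner_factor (x : R) : R :=
  \sum_(1 <= m < N) (- x) ^+ m *+ (2 * m).-1.

(** The index [l] stands for the largest part [l.+1]. The factors carry the sign [(-1)] to the
    number of parts, and the leading minus corrects it to the exponent [num_parts p - 1]. *)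
Definition partition_series (q : R) : R :=
  \sum_(l < N) - largest_factor (q ^+ l.+1) *
    \prod_(i < l) inner_factor (q ^+ i.+1).

Definition divisor_series (q : R) : R :=
  \sum_(k < N) q ^+ (k.+1 ^ 2) * (1 - q ^+ k.+1) * geom_series (q ^+ k.+1).

Lemma geom_seriesP (x : R) : x ^+ N = 0 -> (1 + x) * geom_series x = 1.
Proof.
move=> xN; have := subrX1 (- x) N; rewrite exprNn xN mulr0 sub0r => h.
by rewrite -[RHS]opprK h -mulNr opprB opprK.
Qed.

Lemma largest_factorE (x g : R) :
  x ^+ N = 0 -> (1 + x) * g = 1 -> largest_factor x = - x * g ^+ 2.
Proof.
move=> xN xg; suff h : (1 + x) ^+ 2 * largest_factor x = - x.
  by rewrite -h mulrAC -exprMn xg expr1n mul1r.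
have [N0|N_gt0] := posnP N.
  by move: xN; rewrite N0 expr0 => /eqP; rewrite oner_eq0.
(* Multiplying by [(1 + x) ^+ 2] takes a double difference of the coefficients, so beyond the main
   term only two boundary terms remain. At [M.+1 = N] both contain [x ^+ N] and vanish. *)
have partial M : (1 + x) ^+ 2 * \sum_(1 <= m < M.+1) (- x) ^+ m *+ m =
    - x - M.+1%:R * (- x) ^+ M.+1 + M%:R * (- x) ^+ M.+2.
  elim: M => [|M IHM]; first by rewrite big_geq //; ring.
  rewrite big_nat_recr //= mulrDr IHM !exprS -mulr_natr -!natr1; ring.
rewrite /largest_factor -(prednK N_gt0) partial prednK // exprSr exprNn xN.
by ring.
Qed.

Lemma inner_factorE (x g : R) :
  x ^+ N = 0 -> (1 + x) * g = 1 -> inner_factor x = - x * (1 - x) * g ^+ 2.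
Proof.
move=> xN xg; suff h : (1 + x) ^+ 2 * inner_factor x = - x * (1 - x).
  by rewrite -h mulrAC -exprMn xg expr1n mul1r.
have [N0|N_gt0] := posnP N.
  by move: xN; rewrite N0 expr0 => /eqP; rewrite oner_eq0.
have partial M : (1 + x) ^+ 2 * \sum_(1 <= m < M.+1) (- x) ^+ m *+ (2 * m).-1 =
    - x * (1 - x) - (2 * M%:R + 1) * (- x) ^+ M.+1 +
      (2 * M%:R - 1) * (- x) ^+ M.+2.
  elim: M => [|M IHM]; first by rewrite big_geq //; ring.
  rewrite big_nat_recr //.
  have -> : (2 * M.+1).-1 = (2 * M).+1 by lia.
  by rewrite mulrDr IHM !exprS -[_ *+ (2 * M).+1]mulr_natr -!natr1 natrM; ring.
rewrite /inner_factor -(prednK N_gt0) partial prednK // exprSr exprNn xN.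
by ring.
Qed.

(** * The WZ pair and the telescoping double sum *)

Section Telescoping.
Variable q : R.
Hypothesis qN : q ^+ N = 0.

Let exp_small m : (N <= m)%N -> q ^+ m = 0.
Proof. by move/subnK <-; rewrite exprD qN mulr0. Qed.

Let g i := geom_series (q ^+ i).

Let gP i : (0 < i)%N -> (1 + q ^+ i) * g i = 1.
Proof.
by move=> i_gt0; rewrite geom_seriesP // -exprM exp_small ?leq_pmull.
Qed.

(* In closed form, with j = m - 1,
   (-1)^(m-1) q^(m(m+1)/2 + 2km + k^2) (q; q)_(m-1) / (-q^(k+1); q)_m^2;
   the wz j 0 are the terms of the partition series, and the mate
   wz j k * (1 - q^(2k + j + 2)) at j = 0 gives those of the divisor series. *)
Fixpoint wz (j k : nat) : R :=
  if j is j'.+1 then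
    - (q ^+ (j' + 2 + 2 * k) * (1 - q ^+ j'.+1) * g (k + j' + 2) ^+ 2 * wz j' k)
  else q ^+ (k.+1 ^ 2) * g k.+1 ^+ 2.

(** Raising [k] shifts the window of squared [g] factors by one index, so their ratio involves only
    the factor leaving and the factor entering. *)
Lemma wz_shift j k : wz j k.+1 =
  q ^+ (2 * k + 2 * j + 3) * (1 + q ^+ k.+1) ^+ 2 * g (k + j + 2) ^+ 2 * wz j k.
Proof.
elim: j => [|j IHj] /=.
  rewrite muln0 !addn0 addn2.
  have -> : (k.+2 ^ 2 = 2 * k + 3 + k.+1 ^ 2)%N by lia.
  (* This form of 1 supplies the factor [g k.+1 ^+ 2] that only the right-hand side contains. *)
  have e : 1 = ((1 + q ^+ k.+1) * g k.+1) ^+ 2 by rewrite gP // expr1n.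
  by rewrite exprD -[LHS]mul1r [X in X * _ = _]e; ring.
rewrite IHj.
have -> : (j + 2 + 2 * k.+1 = 2 + (j + 2 + 2 * k))%N by lia.
have -> : (2 * k + 2 * j.+1 + 3 = 2 + (2 * k + 2 * j + 3))%N by lia.
have -> : (k.+1 + j + 2 = k + j.+1 + 2)%N by lia.
by rewrite (exprD q 2 (j + 2 + 2 * k)) (exprD q 2 (2 * k + 2 * j + 3)); ring.
Qed.

(** All terms are multiples of [wz j k]. Once each carries the common factor [h ^+ 2], what remains
    is a polynomial identity in [q], [q ^+ j] and [q ^+ k]. *)
Lemma wz_telescope j k :
  wz j k - wz j k.+1 =
  wz j k * (1 - q ^+ (2 * k + j + 2)) -
  wz j.+1 k * (1 - q ^+ (2 * k + j.+1 + 2)).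
Proof.
rewrite wz_shift /=; set h := g _; set f := wz j k.
have hP : (1 + q ^+ (k + j + 2)) * h = 1 by apply: gP; lia.
have fE : f = (1 + q ^+ (k + j + 2)) ^+ 2 * h ^+ 2 * f.
  by rewrite -exprMn hP expr1n mul1r.
rewrite [X in X - _ = _]fE [X in _ = X * _ - _]fE.
have -> : (2 * k + 2 * j + 3 = k + k + j + j + 3)%N by lia.
have -> : (2 * k + j + 2 = k + k + j + 2)%N by lia.
have -> : (j + 2 + 2 * k = k + k + j + 2)%N by lia.
have -> : (2 * k + j.+1 + 2 = k + k + j + 3)%N by lia.
rewrite !exprS !exprD; ring.
Qed.

(** Here [1 - q ^+ (2 * k + 2)] is a difference of squares, and its factor [1 + q ^+ k.+1] cancels
    one of the two [g k.+1]. *)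
Lemma wz0_row k : wz 0 k * (1 - q ^+ (2 * k + 0 + 2)) =
  q ^+ (k.+1 ^ 2) * (1 - q ^+ k.+1) * g k.+1.
Proof.
rewrite /= addn0; have -> : (2 * k + 2 = k.+1 + k.+1)%N by lia.
by rewrite exprD -[RHS]mul1r -[X in _ = X * _](@gP k.+1) //; ring.
Qed.

Lemma wz_col0 l : wz l 0 =
  - largest_factor (q ^+ l.+1) * \prod_(i < l) inner_factor (q ^+ i.+1).
Proof.
have qiN i : (q ^+ i.+1) ^+ N = 0 by rewrite -exprM exp_small ?leq_pmull.
rewrite (largest_factorE (qiN l) (gP _)) //.
elim: l => [|l IHl] /=; first by rewrite big_ord0 exp1n; ring.
rewrite big_ord_recr /= (inner_factorE (qiN l) (gP _)) // IHl.
have -> : (l + 2 + 2 * 0 = l.+2)%N by lia.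
have -> : (0 + l + 2 = l.+2)%N by lia.
by ring.
Qed.

(** Each step of the recursion brings at least one more [q]. Nilpotency of [q] then kills the
    boundary terms of both telescoping sums. *)
Lemma exp_dvd_wz j k : exists c, wz j k = q ^+ (j + k.+1 ^ 2) * c.
Proof.
elim: j => [|j [c IHj]] /=; first by exists (g k.+1 ^+ 2).
have -> : (j + 2 + 2 * k = (j + 1 + 2 * k).+1)%N by lia.
set h := g _; exists (- (q ^+ (j + 1 + 2 * k) * (1 - q ^+ j.+1) * h ^+ 2 * c)).
by rewrite IHj addSn !exprS; ring.
Qed.

Lemma wz_eq0 j k : (N <= j + k.+1 ^ 2)%N -> wz j k = 0.
Proof. by have [c ->] := exp_dvd_wz j k => /exp_small->; rewrite mul0r. Qed.

Lemma partition_seriesE : partition_series q = divisor_series q.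
Proof.
rewrite /partition_series; under eq_bigr do rewrite -wz_col0.
(* [S 0] is the partition series and [S N] vanishes. Each difference of consecutive values collapses
   in [j] to its [j = 0] end, which is a term of the divisor series. *)
pose S k := \sum_(j < N) wz j k.
have S_step k : S k - S k.+1 = wz 0 k * (1 - q ^+ (2 * k + 0 + 2)).
  rewrite /S -sumrB; under eq_bigr do rewrite wz_telescope.
  rewrite -(big_mkord xpredT (fun j => wz j k * (1 - q ^+ (2 * k + j + 2)) -
    wz j.+1 k * (1 - q ^+ (2 * k + j.+1 + 2)))).
  rewrite -[LHS]opprK -sumrN; under eq_bigr do rewrite opprB.
  rewrite telescope_sumr // wz_eq0 ?leq_addr //; ring.
have S_N : S N = 0.
  by apply: big1 => j _; apply: wz_eq0; nia.
have := telescope_sumr S (leq0n N); rewrite S_N sub0r => S0.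
rewrite -[LHS]opprK -/(S 0%N) -S0 -sumrN big_mkord; apply: eq_bigr => k _.
by rewrite opprB S_step wz0_row.
Qed.

End Telescoping.
End Series.

(** * Transfer from the truncated polynomial ring to integer coefficients *)

Lemma rmorph_partition_series (R S : comNzRingType) (f : {rmorphism R -> S})
    N q : f (partition_series N q) = partition_series N (f q).
Proof.
have eNX i m : f ((- q ^+ i) ^+ m) = (- f q ^+ i) ^+ m.
  by rewrite rmorphXn rmorphN rmorphXn.
rewrite rmorph_sum; apply: eq_bigr => l _.
rewrite rmorphM rmorphN rmorph_sum rmorph_prod.
congr (- _ * _); last apply: eq_bigr => i _; rewrite ?rmorph_sum.
  by apply: eq_bigr => m _; rewrite rmorphMn /= eNX.
by apply: eq_bigr => m _; rewrite rmorphMn /= eNX.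
Qed.

Lemma rmorph_divisor_series (R S : comNzRingType) (f : {rmorphism R -> S})
    N q : f (divisor_series N q) = divisor_series N (f q).
Proof.
rewrite rmorph_sum; apply: eq_bigr => k _.
rewrite !rmorphM rmorphB rmorph1 !rmorphXn rmorph_sum.
by congr (_ * _); apply: eq_bigr => j _; rewrite rmorphXn rmorphN rmorphXn.
Qed.

Lemma in_qpolyXn_coef (R : comNzRingType) (N : nat) (p r : {poly R}) (i : nat) :
  in_qpoly 'X^(N.+1) p = in_qpoly 'X^(N.+1) r -> (i <= N)%N -> p`_i = r`_i.
Proof.
move=> /(congr1 val) /=; rewrite mk_monic_Xn /= => pr i_le.
have mX : ('X^(N.+1) : {poly R}) \is monic by exact: monicXn.
rewrite (Pdiv.RingMonic.rdivp_eq mX p) (Pdiv.RingMonic.rdivp_eq mX r) pr.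
by rewrite !coefD !coefMXn ltnS i_le.
Qed.

(** In the quotient by ['X^(n.+1)] the class of ['X] is nilpotent, so [partition_seriesE] applies
    there; coefficients up to [n] survive the quotient. *)
Lemma coef_partition_divisor_series n :
  (partition_series n.+1 'X)`_n = (divisor_series n.+1 'X)`_n :> int.
Proof.
apply: in_qpolyXn_coef (leqnn n).
rewrite rmorph_partition_series rmorph_divisor_series partition_seriesE //.
rewrite -rmorphXn; apply: val_inj => /=.
by rewrite mk_monic_Xn /= Pdiv.RingMonic.rmodpp // monicXn.
Qed.

(** * Coefficients of the divisor series *)

Lemma sum_signed_multiples (n K a : nat) : (0 < K)%N -> (0 < a)%N ->
  \sum_(j < n.+1) (-1) ^+ j *+ (n == K * (a + j))%N =
  (-1) ^+ (n %/ K - a) *+ ((K %| n) && (a <= n %/ K))%N :> int.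
Proof.
move=> K_gt0 a_gt0; have [Kn|nKn] /= := boolP (K %| n)%N; last first.
  rewrite big1 // => j _; case: eqP => // nE.
  by rewrite nE dvdn_mulr in nKn.
have eqE (j : 'I_n.+1) : (n == K * (a + j))%N = (n %/ K == a + j)%N.
  by rewrite -{1}(divnK Kn) mulnC eqn_pmul2l.
under eq_bigr do rewrite eqE.
case: leqP => [a_le|lt_a]; last first.
  by rewrite big1 // => j _; case: eqP => // e; move: lt_a; rewrite e; lia.
have lt_n : (n %/ K - a < n.+1)%N.
  by rewrite ltnS (leq_trans (leq_subr _ _)) // leq_div.
rewrite (bigD1 (Ordinal lt_n)) //= subnKC // eqxx big1 ?addr0 // => j nj.
case: eqP => // e; case/negP: nj; apply/eqP/val_inj => /=; lia.
Qed.

(** The product is a difference of two alternating series with exponents [K * (K + j)] and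
    [K * (K.+1 + j)]. For a codivisor above [K] both hit [n] with opposite signs, so the difference
    doubles; for a codivisor equal to [K] only the first does. *)
Lemma coef_divisor_term (n K : nat) : (0 < K)%N ->
  ('X^(K ^ 2) * (1 - 'X^K) * geom_series n.+1 'X^K)`_n =
  (-1) ^+ (K + n %/ K) *+ (K %| n)%N *+ ((K <= n %/ K) + (K < n %/ K))%N :> int.
Proof.
move=> K_gt0.
have expand : 'X^(K ^ 2) * (1 - 'X^K) * geom_series n.+1 'X^K =
    \sum_(j < n.+1) (-1) ^+ j *: 'X^(K * (K + j)) -
    \sum_(j < n.+1) (-1) ^+ j *: 'X^(K * (K.+1 + j)) :> {poly int}.
  rewrite -sumrB mulr_sumr; apply: eq_bigr => j _.
  rewrite (exprNn 'X^K) -exprM -(signr_odd _ j) -!(signr_odd int j).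
  have -> : (K * (K + j) = K ^ 2 + K * j)%N by lia.
  have -> : (K * (K.+1 + j) = K ^ 2 + K + K * j)%N by lia.
  rewrite !exprD.
  by case: (odd j); rewrite ?expr1 ?expr0 ?scaleN1r ?scale1r; ring.
rewrite expand coefB !coef_sum.
have coefE a : \sum_(j < n.+1) ((-1) ^+ j *: 'X^(K * (a + j)))`_n =
    \sum_(j < n.+1) (-1) ^+ j *+ (n == K * (a + j))%N :> int.
  by apply: eq_bigr => j _; rewrite coefZ coefXn mulr_natr.
rewrite !coefE !sum_signed_multiples //.
case: (K %| n)%N; last by rewrite !mulr0n subrr mul0rn.
rewrite /= mulr1n; case: ltngtP => [lt|gt|<-]; rewrite ?mulr0n ?subrr //.
  rewrite !mulr1n -signr_odd -[X in _ - X]signr_odd -[in RHS]signr_odd.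
  have -> : odd (K + n %/ K) = odd (n %/ K - K).
    by rewrite oddB ?(ltnW lt) // oddD addbC.
  have -> : odd (n %/ K - K.+1) = ~~ odd (n %/ K - K).
    by rewrite !oddB ?(ltnW lt) //= addbN.
  by case: odd.
by rewrite subnn mulr1n subr0 addn0 expr0 -signr_odd oddD addbb.
Qed.

Lemma perm_divisors n : (0 < n)%N ->
  perm_eq [seq i.+1 | i <- index_iota 0 n.+1 & (i.+1 %| n)%N] (divisors n).
Proof.
move=> n_gt0; apply: uniq_perm; rewrite ?divisors_uniq //.
  by rewrite map_inj_uniq ?filter_uniq ?iota_uniq //; exact: succn_inj.
move=> d; rewrite -dvdn_divisors //; apply/mapP/idP.
  by case=> i; rewrite mem_filter => /andP[h _] ->.
move=> dn; have d_gt0 := dvdn_gt0 n_gt0 dn.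
exists d.-1; last by rewrite prednK.
rewrite mem_filter prednK // dn mem_index_iota /=.
by have := dvdn_leq n_gt0 dn; lia.
Qed.

Lemma divn_divn n d : (0 < n)%N -> (d %| n)%N -> (n %/ (n %/ d) = d)%N.
Proof. by move=> n_gt0 dn; rewrite divnA // mulKn. Qed.

Lemma perm_codivisors n :
  (0 < n)%N -> perm_eq [seq (n %/ d)%N | d <- divisors n] (divisors n).
Proof.
move=> n_gt0; apply: uniq_perm; rewrite ?divisors_uniq //.
  rewrite map_inj_in_uniq ?divisors_uniq // => d e.
  rewrite -!dvdn_divisors // => dn en eq_de.
  by rewrite -(divn_divn n_gt0 dn) eq_de divn_divn.
move=> d; apply/mapP/idP => [[e]|].
  by rewrite -!dvdn_divisors // => en ->; apply: dvdn_div.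
rewrite -dvdn_divisors // => dn; exists (n %/ d)%N.
  by rewrite -dvdn_divisors //; apply: dvdn_div.
by rewrite divn_divn.
Qed.

(** The sign is symmetric under exchanging [d] and [n %/ d]. Applying this exchange to the strict
    half [d < n %/ d] gives exactly the divisors missing from [d <= n %/ d]. *)
Lemma coef_divisor_series n : (0 < n)%N ->
  (divisor_series n.+1 'X)`_n =
  \sum_(d <- divisors n) (-1) ^+ (d + n %/ d) :> int.
Proof.
move=> n_gt0; rewrite coef_sum.
under eq_bigr do rewrite coef_divisor_term //.
pose F d : int := (-1) ^+ (d + n %/ d) *+ ((d <= n %/ d) + (d < n %/ d))%N.
transitivity (\sum_(d <- divisors n) F d).
  rewrite -(perm_big _ (perm_divisors n_gt0)) big_map big_filter.
  rewrite big_mkord [RHS]big_mkcond.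
  by apply: eq_bigr => i _; rewrite /F; case: (_ %| _)%N; rewrite ?mul0rn.
under eq_bigr do rewrite /F mulrnDr.
rewrite big_split /= -[X in _ + X](perm_big _ (perm_codivisors n_gt0)) big_map.
rewrite -big_split big_seq [RHS]big_seq; apply: eq_bigr => d.
rewrite -dvdn_divisors // => dn.
by rewrite /= divn_divn // addnC -mulrnDr; case: leqP.
Qed.

(** For odd [n] every sign is 1. For even [n] a divisor and its codivisor are never both odd, so the
    sign is -1 exactly when one of them is; this subtracts four times the number of odd divisors,
    and doubling maps these onto the divisors congruent to 2 modulo 4. *)
Lemma sum_codivisors_sign n : (0 < n)%N ->
  \sum_(d <- divisors n) (-1) ^+ (d + n %/ d) =
  (num_divisors n)%:Z - 4 * (num_divisors_2_4 n)%:Z.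
Proof.
move=> n_gt0.
have sum1 : \sum_(d <- divisors n) 1 = (num_divisors n)%:Z.
  by rewrite -[RHS]natz /num_divisors -sum1_size natr_sum.
have [n_odd|n_even] := boolP (odd n).
  have odd_d d : d \in divisors n -> odd d.
    by rewrite -dvdn_divisors // => /dvdn_odd; apply.
  have -> : num_divisors_2_4 n = 0%N.
    apply/eqP; rewrite -leqn0 leqNgt -has_count; apply/hasPn => d /odd_d.
    by apply: contraL; lia.
  rewrite mulr0 subr0 big_seq (eq_bigr (fun=> 1)); last first.
    move=> d dn; rewrite -signr_odd oddD !odd_d //.
    by move: dn; rewrite -!dvdn_divisors //; apply: dvdn_div.
  by rewrite -big_seq sum1.
have signE d : d \in divisors n ->
    (-1) ^+ (d + n %/ d) = 1 - 2 * (odd d)%:Z - 2 * (odd (n %/ d))%:Z.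
  rewrite -dvdn_divisors // => dn; rewrite -signr_odd oddD.
  have : ~~ (odd d && odd (n %/ d)).
    by rewrite andbC -oddM divnK.
  by case: (odd d); case: (odd _).
rewrite big_seq (eq_bigr _ signE) -big_seq !sumrB.
have codiv : \sum_(d <- divisors n) 2 * (odd (n %/ d))%:Z =
    \sum_(d <- divisors n) 2 * (odd d)%:Z.
  by rewrite -[RHS](perm_big _ (perm_codivisors n_gt0)) big_map.
have odd_count : count odd (divisors n) = num_divisors_2_4 n.
  rewrite /num_divisors_2_4 -!size_filter -(size_map double).
  apply: perm_size; apply: uniq_perm.
  - by rewrite map_inj_uniq ?filter_uniq ?divisors_uniq //; exact: double_inj.
  - by rewrite filter_uniq ?divisors_uniq.
  move=> d; rewrite mem_filter -dvdn_divisors //.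
  apply/mapP/andP => [[e]|[d24 dn]].
    rewrite mem_filter -dvdn_divisors // => /andP[oe en] ->; split; first lia.
    rewrite -mul2n Gauss_dvd ?coprime2n // en andbT; lia.
  exists d./2; last by lia.
  rewrite mem_filter -dvdn_divisors //; apply/andP; split; first lia.
  by apply: dvdn_trans dn; apply/dvdnP; exists 2; lia.
rewrite codiv -mulr_sumr -odd_count.
have -> : \sum_(d <- divisors n) (odd d)%:Z = (count odd (divisors n))%:Z.
  rewrite -[RHS]natz -sum1_count natr_sum [RHS]big_mkcond /=.
  by apply: eq_bigr => d _; case: odd.
by rewrite sum1; ring.
Qed.

(** * Gap-free partitions encoded by their multiplicities *)

Lemma sum_by_mult (s : seq nat) (L : nat) (F : nat -> nat) :
  {in s, forall x, 0 < x <= L}%N ->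
  (\sum_(x <- s) F x = \sum_(i < L) count_mem i.+1 s * F i.+1)%N.
Proof.
elim: s => [|y s IHs] sL.
  by rewrite big_nil big1.
rewrite big_cons IHs => [|x xs]; last by apply: sL; rewrite inE xs orbT.
have /andP[y_gt0 y_le] := sL y (mem_head y s).
have y_lt : (y.-1 < L)%N by rewrite prednK.
under [RHS]eq_bigr do rewrite /= mulnDl.
rewrite big_split /=; congr (_ + _)%N.
rewrite (bigD1 (Ordinal y_lt)) //= prednK // eqxx mul1n big1 ?addn0 // => i ni.
by case: eqP => // yE; case/negP: ni; apply/eqP/val_inj; rewrite /= yE.
Qed.

Lemma perm_eq_mult (s t : seq nat) (L : nat) :
  {in s, forall x, 0 < x <= L}%N -> {in t, forall x, 0 < x <= L}%N ->
  (forall i : 'I_L, count_mem i.+1 s = count_mem i.+1 t) -> perm_eq s t.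
Proof.
move=> sL tL st; apply/allP => x; rewrite mem_cat => x_st /=.
have /andP[x_gt0 x_le] : (0 < x <= L)%N by case/orP: x_st => [/sL|/tL].
have x_lt : (x.-1 < L)%N by rewrite prednK.
by have := st (Ordinal x_lt); rewrite /= prednK // => ->.
Qed.

Section Multiplicities.
Variables (n l : nat).
Implicit Types (p : partition_of n) (f : {ffun 'I_l.+1 -> 'I_n.+1}).

Definition gap_free_with_largest : pred (partition_of n) :=
  [pred p | (p \in Pstar n) && (largest_part p == l.+1)].

(** Index [i] records the part [i.+1]. No multiplicity exceeds [n], so [inord] loses nothing. *)
Definition mult_fun p : {ffun 'I_l.+1 -> 'I_n.+1} :=
  [ffun i : 'I_l.+1 => inord (mult p i.+1)].

Definition mult_weight f := (\sum_(i < l.+1) i.+1 * f i)%N.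

Lemma gap_free_mem p :
  p \in gap_free_with_largest -> parts p =i [pred x | 0 < x <= l.+1]%N.
Proof.
rewrite !inE => /andP[gf /eqP lp] x; rewrite -mem_undup.
by rewrite (perm_mem gf) mem_iota lp !inE add1n ltnS.
Qed.

Lemma mult_le p j : (mult p j <= n)%N.
Proof.
case: p => s sP; rewrite /mult /=; have /and3P[_ s0 /eqP <-] := sP.
by rewrite (leq_trans (count_size _ _)) // size_leq_sumn.
Qed.

Lemma mult_funE p i : mult_fun p i = mult p i.+1 :> nat.
Proof. by rewrite ffunE inordK // ltnS mult_le. Qed.

Lemma mult_fun_gt0 p i : p \in gap_free_with_largest -> (0 < mult_fun p i)%N.
Proof.
move=> /gap_free_mem memp; rewrite mult_funE -has_count has_pred1 memp !inE.
by rewrite /= ltn_ord.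
Qed.

Lemma mult_weightE p :
  p \in gap_free_with_largest -> mult_weight (mult_fun p) = n.
Proof.
move=> pP; have /and3P[_ _ /eqP pn] := parts_partition p.
rewrite -[RHS]pn sumnE (@sum_by_mult _ l.+1) => [|x]; last first.
  by rewrite (gap_free_mem pP).
by apply: eq_bigr => i _; rewrite mult_funE mulnC.
Qed.

Lemma num_partsE p : p \in gap_free_with_largest ->
  num_parts p = (\sum_(i < l.+1) mult_fun p i)%N.
Proof.
move=> pP; rewrite /num_parts -sum1_size (@sum_by_mult _ l.+1) => [|x].
  by apply: eq_bigr => i _; rewrite mult_funE muln1.
by rewrite (gap_free_mem pP).
Qed.

Lemma mult_fun_inj : {in gap_free_with_largest &, injective mult_fun}.
Proof.
move=> p r pP rP pr; apply: val_inj => /=.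
have /and3P[p_sorted _ _] := parts_partition p.
have /and3P[r_sorted _ _] := parts_partition r.
apply: (sorted_eq _ _ p_sorted r_sorted).
- by move=> y x z /= xy yz; apply: leq_trans yz xy.
- by move=> x y; rewrite /= andbC -eqn_leq => /eqP.
apply: (@perm_eq_mult _ _ l.+1) => [x|x|i].
- by rewrite (gap_free_mem pP).
- by rewrite (gap_free_mem rP).
by have := congr1 (fun f => nat_of_ord (f i)) pr; rewrite !mult_funE.
Qed.

(** The preimage lists [f i] copies of each [i.+1] in decreasing order; positivity of [f] makes it
    gap-free with largest part [l.+1]. *)
Lemma mult_fun_onto f : (forall i, 0 < f i)%N -> mult_weight f = n ->
  exists2 p, p \in gap_free_with_largest & f = mult_fun p.
Proof.
move=> f_gt0 fn.
pose s := sort geq (flatten [seq nseq (f i) i.+1 | i : 'I_l.+1]).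
have s_count (j : 'I_l.+1) : count_mem j.+1 s = f j.
  rewrite /s count_sort count_flatten -map_comp sumnE big_map big_enum /=.
  rewrite (bigD1 j) //= count_nseq /= eqxx mul1n big1 ?addn0 // => i ij.
  by rewrite count_nseq /= eqSS (inj_eq val_inj) (negbTE ij).
have s_mem : s =i [pred x | 0 < x <= l.+1]%N.
  move=> x; rewrite mem_sort; apply/flatten_mapP/andP => [[i _]|[x_gt0 x_le]].
    by rewrite mem_nseq => /andP[_ /eqP ->].
  have x_lt : (x.-1 < l.+1)%N by rewrite prednK.
  exists (Ordinal x_lt); first by rewrite mem_enum.
  by rewrite mem_nseq f_gt0 /= prednK.
have s_partition : is_partition n s.
  apply/and3P; split.
  - by apply: sort_sorted => x y; rewrite /= leq_total.
  - by rewrite s_mem.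
  rewrite sumnE (@sum_by_mult _ l.+1) => [|x]; last by rewrite s_mem.
  by rewrite -fn; apply/eqP/eq_bigr => i _; rewrite s_count mulnC.
exists (PartitionOf s_partition); last first.
  apply/ffunP => i; apply: val_inj.
  by rewrite /= mult_funE /mult s_count.
have lP : largest_part (PartitionOf s_partition) = l.+1.
  apply/eqP; rewrite eqn_leq; apply/andP; split.
    by apply/bigmax_leqP_seq => x /=; rewrite s_mem => /andP[].
  by apply: leq_bigmax_seq => //=; rewrite s_mem !inE leqnn.
rewrite !inE lP eqxx andbT /gap_free lP.
apply: uniq_perm; rewrite ?undup_uniq ?iota_uniq // => x.
by rewrite mem_undup s_mem mem_iota !inE add1n ltnS.
Qed.

(** * From weighted partitions to coefficients of the partition series *)

Definition mult_coef f : int :=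
  (f ord_max)%:Z * \prod_(i < l) (2 * (f (widen_ord (leqnSn l) i))%:Z - 1).

Lemma omegaE p :
  p \in gap_free_with_largest -> omega p = mult_coef (mult_fun p).
Proof.
move=> pP; have /andP[_ /eqP lp] := pP; rewrite /omega lp /mult_coef mult_funE.
rewrite big_add1 /= big_mkord; congr (_ * _); apply: eq_bigr => i _.
by rewrite mult_funE.
Qed.

Lemma sum_gap_free_with_largest :
  \sum_(p in gap_free_with_largest) (-1) ^+ (num_parts p - 1) * omega p =
  \sum_(f : {ffun 'I_l.+1 -> 'I_n.+1} |
        [forall i, 0 < f i]%N && (mult_weight f == n))
    - ((-1) ^+ (\sum_(i < l.+1) f i)%N * mult_coef f).
Proof.
pose G f : int := - ((-1) ^+ (\sum_(i < l.+1) f i)%N * mult_coef f).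
transitivity (\sum_(p in gap_free_with_largest) G (mult_fun p)).
  apply: eq_bigr => p pP; rewrite (omegaE pP) /G -num_partsE // -mulNr.
  (* The subtraction in the exponent is truncated, so a nonzero number of parts is required to
     extract the sign. *)
  congr (_ * _); have : (0 < num_parts p)%N.
    rewrite (num_partsE pP) (bigD1 ord0) //=.
    by apply: leq_trans (mult_fun_gt0 ord0 pP) (leq_addr _ _).
  by case: (num_parts p) => // k _; rewrite subn1 exprS mulN1r opprK.
rewrite -(big_imset G mult_fun_inj); apply: eq_bigl => f.
apply/imsetP/andP => [[p pP ->]|[/forallP f_gt0 /eqP fn]].
  split; last by rewrite mult_weightE.
  by apply/forallP => i; exact: mult_fun_gt0.
by have [p pP ->] := mult_fun_onto f_gt0 fn; exists p.
Qed.

(** Distributing the product over the sums picks one multiplicity for each part size, hence one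
    monomial of degree [mult_weight f] for each function [f]. *)
Lemma coef_partition_term :
  (- largest_factor n.+1 'X^(l.+1) *
     \prod_(i < l) inner_factor n.+1 'X^(i.+1))`_n =
  \sum_(p in gap_free_with_largest) (-1) ^+ (num_parts p - 1) * omega p :> int.
Proof.
(* Both branches vanish at [m = 0], the second because [0.-1 = 0]. The sums may therefore start at
   0, and functions with a zero value contribute nothing. *)
pose w (i : 'I_l.+1) (m : nat) : int :=
  if i == ord_max then m%:Z else (2 * m).-1%:Z.
have facE (i : 'I_l.+1) (c : nat -> nat) : c 0%N = 0%N ->
    \sum_(1 <= m < n.+1) (- 'X^(i.+1)) ^+ m *+ c m =
    \sum_(m < n.+1) ((-1) ^+ m * (c m)%:Z) *: 'X^(i.+1 * m) :> {poly int}.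
  move=> c0; rewrite big_ord_recl /= c0 mulr0 scale0r add0r big_add1 /= big_mkord.
  apply: eq_bigr => m _; rewrite /bump leq0n add1n (exprNn 'X^(i.+1)) -exprM.
  rewrite -mulr_natr -mul_polyC rmorphM rmorphXn rmorphN rmorph1 -natz rmorph_nat.
  by ring.
have prodE : largest_factor n.+1 'X^(l.+1) *
    \prod_(i < l) inner_factor n.+1 'X^(i.+1) =
    \prod_(i < l.+1) \sum_(m < n.+1) ((-1) ^+ m * w i m) *: 'X^(i.+1 * m)
    :> {poly int}.
  rewrite big_ord_recr mulrC /=; congr (_ * _).
    apply: eq_bigr => i _; rewrite /inner_factor.
    rewrite (facE (widen_ord (leqnSn l) i) (fun m => (2 * m).-1)) //.
    apply: eq_bigr => m _; rewrite /w ifF //.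
    by apply/negbTE; rewrite -val_eqE /= ltn_eqF.
  rewrite /largest_factor (facE ord_max id) //.
  by apply: eq_bigr => m _; rewrite /w eqxx.
rewrite mulNr coefN prodE bigA_distr_bigA coef_sum sum_gap_free_with_largest.
rewrite sumrN; congr (- _); rewrite [RHS]big_mkcond; apply: eq_bigr => f _.
have -> : \prod_(i < l.+1) (((-1) ^+ f i * w i (f i)) *: 'X^(i.+1 * f i)) =
    ((-1) ^+ (\sum_(i < l.+1) f i)%N * \prod_(i < l.+1) w i (f i)) *:
      'X^(mult_weight f) :> {poly int}.
  by rewrite scaler_prod big_split /= -!prodrXr.
rewrite coefZ coefXn eq_sym.
case: (mult_weight f == n); last by rewrite andbF mulr0.
rewrite andbT mulr1; case: ifPn => [/forallP f_gt0|].
  congr (_ * _); rewrite big_ord_recr /= mulrC /w eqxx; congr (_ * _).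
  apply: eq_bigr => i _; rewrite ifF; last first.
    by apply/negbTE; rewrite -val_eqE /= ltn_eqF.
  by have := f_gt0 (widen_ord (leqnSn l) i); lia.
rewrite negb_forall => /existsP[i]; rewrite -eqn0Ngt => /eqP fi0.
have wi0 : w i (f i) = 0 by rewrite /w fi0; case: ifP.
by rewrite [X in _ * X](bigD1 i) //= wi0 mul0r mulr0.
Qed.

End Multiplicities.

Lemma coef_partition_seriesE n : (0 < n)%N ->
  (partition_series n.+1 'X)`_n =
  \sum_(p in Pstar n) (-1) ^+ (num_parts p - 1) * omega p :> int.
Proof.
move=> n_gt0; rewrite coef_sum; under eq_bigr do rewrite coef_partition_term.
(* Partitions are sorted by largest part. The shifted index is faithful because the largest part
   lies between 1 and [n], the lower bound coming from [0 < n]. *)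
rewrite (partition_big (fun p => inord (largest_part p).-1 : 'I_n.+1) xpredT) //=.
apply: eq_bigr => l _; apply: eq_bigl => p; rewrite !inE; congr (_ && _).
have /and3P[_ p0 /eqP pn] := parts_partition p.
have l_le : (largest_part p <= n)%N.
  by apply/bigmax_leqP_seq => x xp _; rewrite -pn; exact: leq_sumn_mem.
have l_gt0 : (0 < largest_part p)%N.
  move: pn n_gt0; rewrite /largest_part; case: (parts p) p0 => [|x s] /=.
    by move=> _ <-.
  rewrite inE negb_or big_cons => /andP[x0 _] _ _.
  by rewrite leq_max lt0n eq_sym x0.
by rewrite -val_eqE /= inordK; lia.
Qed.

Theorem theorem2p6 (n : nat) (n_gt0 : (0 < n)%N) :
  (num_divisors n)%:Z - 4 * (num_divisors_2_4 n)%:Z =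
  \sum_(p in Pstar n) (-1) ^+ (num_parts p - 1) * omega p.
Proof.
rewrite -sum_codivisors_sign // -coef_divisor_series //.
rewrite -coef_partition_divisor_series.
exact: coef_partition_seriesE.
Qed.
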